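(* Let $n\in\mathbb{N}$, $k\geq2$, $u\equiv a_{i_1}a_{i_2}\cdots a_{i_k}$ with $a_{i_j}\in\{a_1,\dots,a_n\}$, and let $S=sgp\langle a_1,\dots,a_n\mid u=\varepsilon\rangle$, where $\{u=\varepsilon\}$ is a Gröbner–Shirshov basis. Then $S$ is biautomatic.
   Context: $A^*$ is the free monoid (empty word $\varepsilon$), $A^+=A^*\setminus\{\varepsilon\}$. $sgp\langle A\mid R\rangle$ is the monoid $A^*$ modulo the congruence generated by $R$. Gröbner–Shirshov bases: fix a well-ordering of $A$ and the deg-lex ordering on $A^*$ (length, then lexicographic). For monic polynomials $f,g$ in the free associative algebra $F\langle A\rangle$ over a field with leading words $\bar f,\bar g$: if $w\equiv\bar f b\equiv a\bar g$ with $|\bar f|+|\bar g|>|w|$, $(f,g)_w=fb-ag$; if $w\equiv\bar f\equiv a\bar g b$, $(f,g)_w=f-agb$; trivial modulo $(R,w)$ if it equals $\sum\alpha_i a_i s_i b_i$ with $s_i\in R$, $a_i\bar{s_i}b_i<w$. $R$ is a Gröbner–Shirshov basis if all compositions are trivial; $\{u=\varepsilon\}$ is one if $\{u-1\}$ is. Automaticity: regular = accepted by a finite automaton. With $\$\notin A$, $A(2,\$)=(A\cup\{\$\})^2\setminus\{(\$,\$)\}$; $(\alpha,\beta)\delta_A^R$ (resp. $\delta_A^L$) is the word over $A(2,\$)$ obtained by padding the shorter word on the right (resp. left) with $\$$'s and reading letter pairs. For a semigroup $S$ generated by a finite set $A$, $\phi:A^+\to S$ canonical, $L\subseteq A^+$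 regular with $\phi(L)=S$, write $\alpha=\beta$ if $\phi(\alpha)=\phi(\beta)$, and for $a\in A\cup\{\varepsilon\}$: $L_a^\$=\{(\alpha,\beta)\delta^R_A:\alpha a=\beta\}$, ${}^\$L_a=\{(\alpha,\beta)\delta^L_A:\alpha a=\beta\}$, ${}_aL^\$=\{(\alpha,\beta)\delta^R_A:a\alpha=\beta\}$, ${}^\$_aL=\{(\alpha,\beta)\delta^L_A:a\alpha=\beta\}$ (with $\alpha,\beta\in L$). $S$ is biautomatic if some such $(A,L)$ has all four families regular for all $a\in A\cup\{\varepsilon\}$. A monoid is biautomatic if it is biautomatic as a semigroup (with respect to some finite semigroup generating set). *)

(* Defs.v *)
From mathcomp Require Import all_boot all_order all_algebra.
Set Implicit Arguments. Unset Strict Implicit. Unset Printing Implicit Defensive.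
Import GRing.Theory.

Inductive mcong (T : Type) (R : seq T -> seq T -> Prop) : seq T -> seq T -> Prop :=
| mc_step (x y l r : seq T) : R l r -> mcong R (x ++ l ++ y) (x ++ r ++ y)
| mc_refl (w : seq T) : mcong R w w
| mc_sym (v w : seq T) : mcong R v w -> mcong R w v
| mc_trans (v w z : seq T) : mcong R v w -> mcong R w z -> mcong R v z.

Fixpoint lex_lt (n : nat) (v w : seq 'I_n) : bool :=
  match v, w with
  | [::], [::] => false
  | [::], _ :: _ => true
  | _ :: _, [::] => false
  | x :: v', y :: w' => (x < y)%N || ((x == y) && lex_lt v' w')
  end.

Definition deglex_lt (n : nat) (v w : seq 'I_n) : bool :=
  (size v < size w)%N || ((size v == size w) && lex_lt v w).

(* ---------- Free associative algebra K<a_0..a_(n-1)> ----------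
   A polynomial is represented by a finite list of (coefficient, word)
   terms; its value is the coefficient function [pcoef]. *)
Section FreeAlg.
Variables (n : nat) (K : fieldType).
Local Notation word := (seq 'I_n).

Definition npoly := seq (K * word).

Definition pcoef (f : npoly) (w : word) : K := (\sum_(t <- f | t.2 == w) t.1)%R.

Definition pmul_words (a : word) (f : npoly) (b : word) : npoly :=
  [seq (t.1, a ++ t.2 ++ b) | t <- f].
Definition pscale (c : K) (f : npoly) : npoly := [seq ((c * t.1)%R, t.2) | t <- f].
Definition psub (f g : npoly) : npoly := f ++ [seq ((- t.1)%R, t.2) | t <- g].

Definition leading_word (f : npoly) (w : word) : Prop :=
  pcoef f w = 1%R /\ forall v, pcoef f v != 0%R -> v = w \/ deglex_lt v w.

Definition trivial_mod (R : seq npoly) (h : npoly) (w : word) : Prop :=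
  exists terms : seq (K * word * npoly * word),
    (forall t, t \in terms ->
       t.1.2 \in R /\ exists ls, leading_word t.1.2 ls /\ deglex_lt (t.1.1.2 ++ ls ++ t.2) w) /\
    forall v, pcoef h v =
      pcoef (flatten [seq pscale t.1.1.1 (pmul_words t.1.1.2 t.1.2 t.2) | t <- terms]) v.

Definition GS_basis (R : seq npoly) : Prop :=
  forall f g, f \in R -> g \in R ->
  forall lf lg, leading_word f lf -> leading_word g lg ->
    (forall a b w : word, w = lf ++ b -> w = a ++ lg -> (size w < size lf + size lg)%N ->
        trivial_mod R (psub (pmul_words [::] f b) (pmul_words a g [::])) w) /\
    (forall a b : word, lf = a ++ lg ++ b ->
        trivial_mod R (psub f (pmul_words a g b)) lf).

Definition unit_rel_poly (u : word) : npoly := [:: (1%R, u); ((-1)%R, [::])].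
End FreeAlg.

Definition regular (S : finType) (L : seq S -> Prop) : Prop :=
  exists (Q : finType) (q0 : Q) (F : pred Q) (d : Q -> S -> Q),
    forall w, L w <-> F (foldl d q0 w).

(* ---------- Padded pairs: alphabet A(2,$) ; None plays the role of $ ---------- *)
Definition pad2 (B : finType) := {p : option B * option B | p != (None, None)}.

Definition padR (B : finType) (al be : seq B) : seq (pad2 B) :=
  let m := maxn (size al) (size be) in
  pmap (fun p => (insub p : option (pad2 B)))
    (zip (map Some al ++ nseq (m - size al) None) (map Some be ++ nseq (m - size be) None)).

Definition padL (B : finType) (al be : seq B) : seq (pad2 B) :=
  let m := maxn (size al) (size be) in
  pmap (fun p => (insub p : option (pad2 B)))
    (zip (nseq (m - size al) None ++ map Some al) (nseq (m - size be) None ++ map Some be)).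

(* ---------- Biautomaticity of the monoid sgp<A | R> (as a semigroup) ----------
   B is a finite semigroup generating set, psi b a word over A representing
   the generator b (distinct generators represent distinct elements),
   phi the canonical map B^+ -> S. *)
Definition biautomatic_pres (A : finType) (R : seq A -> seq A -> Prop) : Prop :=
  exists (B : finType) (psi : B -> seq A) (L : seq B -> Prop),
    let phi (be : seq B) := flatten (map psi be) in
    (forall b c, mcong R (psi b) (psi c) -> b = c) /\
    regular L /\
    (forall be, L be -> be <> [::]) /\
    (forall w : seq A, exists be, L be /\ mcong R (phi be) w) /\
    forall a : option B,
      let pa := if a is Some b then psi b else [::] in
      regular (fun x => exists al be, [/\ L al, L be, x = padR al be & mcong R (phi al ++ pa) (phi be)]) /\
      regular (fun x => exists al be, [/\ L al, L be, x = padL al be & mcong R (phi al ++ pa) (phi be)]) /\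
      regular (fun x => exists al be, [/\ L al, L be, x = padR al be & mcong R (pa ++ phi al) (phi be)]) /\
      regular (fun x => exists al be, [/\ L al, L be, x = padL al be & mcong R (pa ++ phi al) (phi be)]).

(* Main.v *)
From Corelib Require Import Setoid.
Require Import Defs.
From mathcomp Require Import all_boot all_order all_algebra zify.
Set Implicit Arguments.
Unset Strict Implicit.
Unset Printing Implicit Defensive.
Import GRing.Theory.

(** The Groebner-Shirshov condition forces [a = b] for every self-overlap
    [u b = a u] of [u] with [|a| < |u|].  Hence overlapping occurrences of [u]
    in a word can be erased interchangeably, and words without factor [u] are
    unique normal forms.  Multiplying a normal form by a letter either appends
    the letter or erases one occurrence of [u] at that end, so the
    multiplication relations are, up to finitely many pairs, of the form
    [beta = alpha s] or [alpha = beta s] with [s] a fixed word.  For right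
    padding such a relation is a diagonal followed by a fixed tail; for left
    padding it is recognised by an automaton that buffers [|s|] letters.  Left
    multiplication reduces to right multiplication by reversing all words. *)

(** * Closure properties of regular languages *)

Section Regular.
Variable S : finType.
Implicit Types (L M : seq S -> Prop) (v w s : seq S).

Lemma regular_ext L M : (forall w, L w <-> M w) -> regular L -> regular M.
Proof.
move=> eLM [Q [q0 [F [d dP]]]]; exists Q, q0, F, d => w.
by rewrite -dP; apply: iff_sym.
Qed.

Lemma regular_true : regular (fun _ : seq S => True).
Proof. by exists unit, tt, xpredT, (fun q _ => q). Qed.

Lemma regular_not L : regular L -> regular (fun w => ~ L w).
Proof.
case=> Q [q0 [F [d dP]]]; exists Q, q0, (predC F), d => w /=.
by rewrite dP; split=> /negP.
Qed.

Lemma regular_and L M : regular L -> regular M -> regular (fun w => L w /\ M w).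
Proof.
case=> Q [q0 [F [d dP]]] [Q' [q0' [F' [d' dP']]]].
exists (Q * Q')%type, (q0, q0'), (fun q => F q.1 && F' q.2).
exists (fun q a => (d q.1 a, d' q.2 a)) => w.
have -> : foldl (fun q a => (d q.1 a, d' q.2 a)) (q0, q0') w =
          (foldl d q0 w, foldl d' q0' w).
  by elim: w (q0) (q0') => //= a w IHw p p'; rewrite IHw.
by rewrite dP dP'; split=> /andP.
Qed.

Lemma regular_or L M : regular L -> regular M -> regular (fun w => L w \/ M w).
Proof.
case=> Q [q0 [F [d dP]]] [Q' [q0' [F' [d' dP']]]].
exists (Q * Q')%type, (q0, q0'), (fun q => F q.1 || F' q.2).
exists (fun q a => (d q.1 a, d' q.2 a)) => w.
have -> : foldl (fun q a => (d q.1 a, d' q.2 a)) (q0, q0') w =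
          (foldl d q0 w, foldl d' q0' w).
  by elim: w (q0) (q0') => //= a w IHw p p'; rewrite IHw.
by rewrite dP dP'; split=> /orP.
Qed.

Lemma regular_andb (b : bool) L : regular L -> regular (fun w => b /\ L w).
Proof.
case: b => [|_]; first by apply: regular_ext => w; split=> [|[]].
by exists unit, tt, pred0, (fun q _ => q) => w; split=> [[]|].
Qed.

(** Taking preimages keeps the backward run deterministic: after reading [w], the state is the set
    of all [q] from which the original automaton accepts [rev w]. *)
Lemma regular_rev L : regular L -> regular (fun w => L (rev w)).
Proof.
case=> Q [q0 [F [d dP]]].
exists {set Q}, [set q | F q], (fun X : {set Q} => q0 \in X).
exists (fun (X : {set Q}) a => [set q | d q a \in X]) => w.
set D := (X in foldl X); rewrite dP.
suff -> : foldl D [set q | F q] w = [set q | F (foldl d q (rev w))].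
  by rewrite inE.
elim/last_ind: w => [|w a IHw]; first by apply/setP=> q; rewrite !inE.
rewrite -[rcons w a]cats1 foldl_cat IHw /= rev_cat /=.
by apply/setP=> q; rewrite !inE.
Qed.

Lemma regular_nil : regular (fun w => w = [::]).
Proof.
exists bool, true, id, (fun _ _ => false) => -[|a w] /=; first by [].
by rewrite (_ : foldl _ _ _ = false) //; elim: w.
Qed.

Lemma regular_cons a L : regular L -> regular (fun w => exists2 v, w = a :: v & L v).
Proof.
case=> Q [q0 [F [d dP]]].
(* [None] is the initial state, [Some None] the sink. *)
exists (option (option Q)), None, (fun q => if q is Some (Some p) then F p else false).
pose D q b := match q with
  | None => if b == a then Some (Some q0) else Some None
  | Some None => Some None
  | Some (Some p) => Some (Some (d p b)) end.
have sinkD w : foldl D (Some None) w = Some None by elim: w.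
have runD p w : foldl D (Some (Some p)) w = Some (Some (foldl d p w)).
  by elim: w p => //= b w IHw p; rewrite IHw.
exists D => -[|b w] /=; first by split=> [[]|].
case: eqP => [-> | ba]; last by rewrite sinkD; split=> [[v []]|].
rewrite runD -dP; split=> [[v []-> //]|Lw]; by exists w.
Qed.

Lemma regular_catl s L : regular L -> regular (fun w => exists2 v, w = s ++ v & L v).
Proof.
move=> rL; elim: s => [|a s IHs].
  by apply: regular_ext rL => w; split=> [?|[v ->]]; first by exists w.
apply: regular_ext (regular_cons a IHs) => w; split=> [[_ -> [v -> Lv]]|[v -> Lv]].
  by exists v.
by exists (s ++ v) => //; exists v.
Qed.

Lemma regular_catr s L : regular L -> regular (fun w => exists2 v, w = v ++ s & L v).
Proof.
move=> /regular_rev/(regular_catl (rev s))/regular_rev.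
apply: regular_ext => w; split=> [[v e Lv]|[v -> Lv]].
  by exists (rev v); rewrite // -(revK w) e rev_cat revK.
by exists (rev v); rewrite ?rev_cat ?revK.
Qed.

Lemma regular_seq1 s : regular (fun w => w = s).
Proof.
apply: regular_ext (regular_catl s regular_nil) => w.
by split=> [[_ -> ->]|->]; [rewrite cats0 | exists [::]; rewrite ?cats0].
Qed.

Lemma regular_some_suffix L :
  regular L -> regular (fun w => exists x y, w = x ++ y /\ L y).
Proof.
case=> Q [q0 [F [d dP]]].
(* The subset automaton runs [d] on all suffixes of the input at once. *)
exists {set Q}, [set q0], (fun X : {set Q} => [exists q in X, F q]).
exists (fun (X : {set Q}) a => q0 |: [set d q a | q in X]) => w.
set D := (X in foldl X).
suff memD q : reflect (exists x y, w = x ++ y /\ foldl d q0 y = q)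
                (q \in foldl D [set q0] w).
  split=> [[x [y [ew /dP Fy]]]|/exists_inP[q /memD[x [y [ew eq]]] Fq]].
    by apply/exists_inP; exists (foldl d q0 y) => //; apply/memD; exists x, y.
  by exists x, y; split=> //; apply/dP; rewrite eq.
elim/last_ind: w q => [|w a IHw] q.
  rewrite /= inE; apply: (iffP eqP) => [->|[x [y [exy <-]]]]; first by exists [::], [::].
  by case: x y exy => [|? ?] [].
rewrite -cats1 foldl_cat /= in_setU1; apply: (iffP orP) => [[/eqP->|]|[x [y [exy <-]]]].
- by exists (w ++ [:: a]), [::]; rewrite cats0.
- case/imsetP=> p /IHw[x [y [-> <-]]] ->; exists x, (y ++ [:: a]).
  by rewrite catA foldl_cat.
- case/lastP: y exy => [|y b]; first by left.
  rewrite -rcons_cat cats1 => /rcons_inj[ew <-]; right.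
  rewrite -cats1 foldl_cat /=; apply: imset_f; apply/IHw; by exists x, y.
Qed.

Lemma regular_all (p : pred S) : regular (fun w => all p w).
Proof.
exists bool, true, id, (fun q a => q && p a) => w.
suff -> : foldl (fun q a => q && p a) true w = all p w by [].
rewrite -[RHS]andTb; elim: w true => [|a w IHw] b /=; first by rewrite andbT.
by rewrite IHw andbA.
Qed.

(* The automaton buffers the last [size s] values of [g] and compares the
   oldest of them with the current value of [f]. *)
Lemma regular_shift (X : finType) (f g : S -> X) (r s : seq X) :
  size r = size s -> regular (fun w => r ++ map g w = map f w ++ s).
Proof.
move=> ers; pose m := size s.
pose D (q : option (m.-tuple X)) a :=
  if q is Some t then
    if head (g a) (rcons t (g a)) == f a then Some [tuple of behead (rcons t (g a))]
    else None
  else None.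
have sinkD w : foldl D None w = None by elim: w.
exists (option (m.-tuple X)), (Some (Tuple (introT eqP ers))).
exists (fun q => if q is Some t then tval t == s else false), D => w.
rewrite -[r in r ++ _]/(tval (Tuple (introT eqP ers))).
elim: w (Tuple _) => [|a w IHw] t /=; first by rewrite cats0; split=> /eqP.
rewrite -cat_rcons; case: eqP => [e|ne].
  rewrite -IHw /=; case: (rcons t (g a)) e (size_rcons t (g a)) => //= b t' <- _.
  by split=> [[]|->].
rewrite sinkD; split=> //; case: (rcons t (g a)) ne (size_rcons t (g a)) => //= b t' ne _.
by case.
Qed.

End Regular.

(** Letters on which [f] is [None] leave the state unchanged. With [f] a projection of pairs, the
    automaton reads one track and skips its padding. *)
Lemma regular_pmap (S T : finType) (f : S -> option T) (L : seq T -> Prop) :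
  regular L -> regular (fun w => L (pmap f w)).
Proof.
case=> Q [q0 [F [d dP]]].
exists Q, q0, F, (fun q a => if f a is Some b then d q b else q) => w.
rewrite dP; suff -> : foldl d q0 (pmap f w) =
  foldl (fun q a => if f a is Some b then d q b else q) q0 w by [].
by elim: w q0 {dP} => //= a w IHw q; rewrite -IHw; case: (f a).
Qed.

Lemma regular_map (S T : finType) (f : S -> T) (L : seq T -> Prop) :
  regular L -> regular (fun w => L (map f w)).
Proof.
move/(regular_pmap (Some \o f)); apply: regular_ext => w.
by suff -> : pmap (Some \o f) w = map f w by []; elim: w => //= a w ->.
Qed.

(** * Padded pairs of words *)

Section Padding.
Variable B : finType.
Implicit Types (al be x s : seq B) (R : seq B -> seq B -> Prop).

(** Right padding in recursive form, with values in plain pairs instead of the subtype [pad2]: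
    inductions run here, and [val_padR] carries the results over. *)
Fixpoint zipR al be : seq (option B * option B) :=
  match al, be with
  | a :: al', b :: be' => (Some a, Some b) :: zipR al' be'
  | [::], _ => [seq (None, Some b) | b <- be]
  | _, [::] => [seq (Some a, None) | a <- al]
  end.

Definition zipL al be := rev (zipR (rev al) (rev be)).

Lemma zipRE al be : let m := maxn (size al) (size be) in
  zip (map Some al ++ nseq (m - size al) None)
      (map Some be ++ nseq (m - size be) None) = zipR al be.
Proof.
elim: al be => [|a al IHal] be /=.
  by rewrite max0n subnn subn0 cats0; elim: be => //= ? ? ->.
case: be => [|b be] /=; last by rewrite -IHal maxnSS !subSS.
by rewrite maxn0 subnn cats0 /=; congr cons; elim: al {IHal} => //= ? ? ->.
Qed.

Lemma map_val_insub (s : seq (option B * option B)) :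
  all (fun p => p != (None, None)) s ->
  map val (pmap (fun p => (insub p : option (pad2 B))) s) = s.
Proof.
move=> s_ok; rewrite (pmap_filter (insubK _)) -[RHS](all_filterP s_ok).
by apply: eq_filter => p; rewrite isSome_insub.
Qed.

Lemma zipR_neq al be : all (fun p => p != (None, None)) (zipR al be).
Proof. by elim: al be => [|a al IHal] [|b be] //=; apply/allP=> _ /mapP[? _ ->]. Qed.

Lemma val_padR al be : map val (padR al be) = zipR al be.
Proof. by rewrite /padR zipRE map_val_insub // zipR_neq. Qed.

Lemma zipLE al be : let m := maxn (size al) (size be) in
  zip (nseq (m - size al) None ++ map Some al)
      (nseq (m - size be) None ++ map Some be) = zipL al be.
Proof.
move=> m; rewrite /zipL -zipRE !size_rev -/m.
have sz (z : seq B) : size z <= m ->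
    size (map Some (rev z) ++ nseq (m - size z) None) = m.
  by move=> /subnKC {2}<-; rewrite size_cat size_nseq size_map size_rev.
have rev_nseq k : rev (nseq k (@None B)) = nseq k None.
  elim: k => //= k IHk.
  by rewrite rev_cons IHk -[_ :: _]/(nseq k.+1 _) -addn1 nseqD cats1.
rewrite rev_zip ?sz ?leq_maxl ?leq_maxr //.
by rewrite !rev_cat !rev_nseq -!map_rev !revK.
Qed.

Lemma val_padL al be : map val (padL al be) = zipL al be.
Proof. by rewrite /padL zipLE map_val_insub // all_rev zipR_neq. Qed.

Lemma zipR_swap al be : map (fun p => (p.2, p.1)) (zipR al be) = zipR be al.
Proof.
elim: al be => [|a al IHal] [|b be] //=; last by rewrite IHal.
  by rewrite -map_comp.
by rewrite -map_comp.
Qed.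

Lemma zipL_swap al be : map (fun p => (p.2, p.1)) (zipL al be) = zipL be al.
Proof. by rewrite map_rev zipR_swap. Qed.

Lemma pmap_fst_zipR al be : pmap fst (zipR al be) = al.
Proof.
elim: al be => [|a al IHal] [|b be] //=; last by rewrite IHal.
  by elim: be.
by congr cons; elim: al {IHal} => //= ? ? ->.
Qed.

Lemma pmap_rev (T X : Type) (f : T -> option X) (s : seq T) :
  pmap f (rev s) = rev (pmap f s).
Proof.
elim: s => //= a s IHs; rewrite rev_cons -cats1 pmap_cat IHs /=.
by case: (f a) => [b|] /=; rewrite ?cats0 // rev_cons cats1.
Qed.

Lemma pmap_fst_zipL al be : pmap fst (zipL al be) = al.
Proof. by rewrite pmap_rev pmap_fst_zipR revK. Qed.

Lemma zipR_catr x s :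
  zipR x (x ++ s) = [seq (Some a, Some a) | a <- x] ++ [seq (None, Some b) | b <- s].
Proof. by elim: x => [|a x /= -> //]; case: s. Qed.

Lemma zipL_catr x s :
  zipL x (x ++ s) = zip (nseq (size s) None ++ map Some x) (map Some (x ++ s)).
Proof.
rewrite -zipLE; have /maxn_idPr -> : size x <= size (x ++ s).
  by rewrite size_cat leq_addr.
by rewrite subnn size_cat addKn.
Qed.

Lemma regular_zipR_catr s : regular (fun w => exists x, w = zipR x (x ++ s)).
Proof.
(* Equal components do not suffice for a diagonal letter: [p.1] must also be a letter, which
   excludes the pair of two padding symbols. *)
have := regular_catr [seq (None, Some b) | b <- s]
  (@regular_all _ (fun p : option B * option B => p.1 && (p.1 == p.2))).
apply: regular_ext => w; split=> [[v -> /allP v_ok]|[x ->]].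
  exists (pmap fst v); rewrite zipR_catr; congr cat.
  elim: v v_ok => //= -[[a|] b] v IHv v_ok; last first.
    by have := v_ok _ (mem_head _ _).
  have /eqP/= <- := v_ok _ (mem_head _ _); congr cons; apply: IHv => p pv.
  by apply: v_ok; rewrite inE pv orbT.
exists [seq (Some a, Some a) | a <- x]; rewrite ?zipR_catr //.
by apply/allP=> _ /mapP[a _ ->] /=.
Qed.

(** The first track is [size s] padding symbols followed by [x], the second is [x ++ s]. So [size s]
    padding symbols before the second track give the same word as [s] after the first track, which
    is the shape of [regular_shift]. *)
Lemma regular_zipL_catr s : regular (fun w => exists x, w = zipL x (x ++ s)).
Proof.
have sz : size (nseq (size s) (@None B)) = size (map Some s).
  by rewrite size_nseq size_map.
have rA := @regular_all _ (fun p : option B * option B => isSome p.2).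
apply: regular_ext (regular_and (regular_shift fst snd sz) rA) => w.
split=> [[e w_ok]|[x ->]]; last first.
  have zz : size (nseq (size s) None ++ map Some x) = size (map Some (x ++ s)).
    by rewrite !size_cat !size_map size_nseq size_cat addnC.
  rewrite zipL_catr; set p1 := _ ++ _ in zz *; set p2 := map _ _ in zz *.
  have e1 : map fst (zip p1 p2) = p1 by apply: unzip1_zip; rewrite zz.
  have e2 : map snd (zip p1 p2) = p2 by apply: unzip2_zip; rewrite zz.
  rewrite -(all_map snd isSome) e1 e2 /p1 /p2 map_cat catA; split=> //.
  by rewrite all_cat !all_map; apply/andP; split; apply/allP.
have [be ebe] : exists be, map snd w = map Some be.
  clear e; elim: w w_ok => [|[a [b|]] w IHw] //=; first by exists [::].
  by move/IHw=> [be ->]; exists (b :: be).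
have szw : size be = size w by rewrite -(size_map Some) -ebe size_map.
rewrite ebe in e.
(* Otherwise position [size be] of [e] would hold a padding symbol on the left and the first letter
   of [s] on the right. *)
have le_s : size s <= size be.
  rewrite leqNgt; apply/negP=> lt_s.
  have := congr1 (fun z => nth None z (size be)) e.
  rewrite nth_cat size_nseq lt_s nth_nseq lt_s nth_cat size_map -szw ltnn subnn.
  by case: (s) lt_s.
pose x := take (size be - size s) be.
have := cat_take_drop (size be - size s) be; rewrite -/x => ebx.
have sx : size x = size be - size s by rewrite size_takel // leq_subr.
move: e; rewrite -{1}ebx map_cat catA => /eqP; rewrite eqseq_cat; last first.
  by rewrite size_cat size_nseq !size_map sx subnKC.
case/andP=> /eqP e1 /eqP/(inj_map Some_inj) e2; rewrite e2 in ebx.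
by exists x; rewrite zipL_catr ebx -ebe e1 zip_unzip.
Qed.

End Padding.

(** * Relations recognised through an abstract padding *)

Section Synchronous.
Variables (B : finType) (zp : seq B -> seq B -> seq (option B * option B)).
Hypothesis zp_fst : forall al be, pmap fst (zp al be) = al.
Hypothesis zp_swap : forall al be, map (fun p => (p.2, p.1)) (zp al be) = zp be al.
Hypothesis zp_catr : forall s, regular (fun w => exists x, w = zp x (x ++ s)).
Implicit Types (P Q : seq B -> seq B -> Prop) (L : seq B -> Prop).

(** [zp] stands for either padding, so the closure properties below are proved once for both. *)
Definition sync P := regular (fun w => exists al be, w = zp al be /\ P al be).

Lemma sync_ext P Q : (forall al be, P al be <-> Q al be) -> sync P -> sync Q.
Proof.
by move=> PQ; apply: regular_ext => w; split=> -[al [be [-> /PQ]]]; exists al, be.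
Qed.

Lemma sync_or P Q : sync P -> sync Q -> sync (fun al be => P al be \/ Q al be).
Proof.
move=> rP rQ; apply: regular_ext (regular_or rP rQ) => w.
split=> [[[al [be [-> ?]]]|[al [be [-> ?]]]]|[al [be [-> [?|?]]]]].
- by exists al, be; split; last left.
- by exists al, be; split; last right.
- by left; exists al, be.
- by right; exists al, be.
Qed.

Lemma sync_andb (b : bool) P : sync P -> sync (fun al be => b /\ P al be).
Proof.
move=> rP; apply: regular_ext (regular_andb b rP) => w.
by split=> [[? [al [be [-> ?]]]]|[al [be [-> [? ?]]]]]; [|split=> //]; exists al, be.
Qed.

Lemma sync_swap P : sync P -> sync (fun al be => P be al).
Proof.
move/(regular_map (fun p => (p.2, p.1))); apply: regular_ext => w.
split=> [[al [be [e ?]]]|[al [be [-> ?]]]]; exists be, al; split=> //.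
rewrite -zp_swap -e -map_comp -[LHS]map_id.
by apply: eq_map => -[].
Qed.

Lemma sync_fst L P : regular L -> sync P -> sync (fun al be => L al /\ P al be).
Proof.
move=> /(regular_pmap (S := (option B * option B)%type) fst) rL rP.
apply: regular_ext (regular_and rL rP) => w.
split=> [[Lw [al [be [e ?]]]]|[al [be [-> [? ?]]]]].
  by exists al, be; rewrite e zp_fst in Lw *.
by rewrite zp_fst; split=> //; exists al, be.
Qed.

Lemma sync_snd L P : regular L -> sync P -> sync (fun al be => L be /\ P al be).
Proof. by move=> rL /sync_swap/(sync_fst rL)/sync_swap. Qed.

Lemma sync_pair x y : sync (fun al be => al = x /\ be = y).
Proof.
apply: regular_ext (regular_seq1 (zp x y)) => w.
by split=> [->|[_ [_ [-> [-> ->]]]] //]; exists x, y.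
Qed.

Lemma sync_catr s : sync (fun al be => be = al ++ s).
Proof.
apply: regular_ext (zp_catr s) => w.
by split=> [[x ->]|[x [_ [-> ->]]]]; exists x => //; exists (x ++ s).
Qed.

End Synchronous.

(** * Normal forms for a single relator *)

(** Let [c] be the part of [x'] beyond [x]. If [c] is at least as long as [u], the occurrences are
    disjoint and [z] lies between them. Otherwise they overlap, and [e] is the part of the second
    one that sticks out of the first. *)
Lemma two_occurrences (T : eqType) (u x y x' y' : seq T) :
  x ++ u ++ y = x' ++ u ++ y' -> size x <= size x' ->
  (exists z, x' = x ++ u ++ z /\ y = z ++ u ++ y') \/
  (exists c e, [/\ size c < size u, x' = x ++ c, y = e ++ y' & u ++ e = c ++ u]).
Proof.
move=> e le_x.
have ex' : x' = x ++ drop (size x) x'.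
  move/(congr1 (take (size x))): e; rewrite take_size_cat // takel_cat // => ex.
  by rewrite {1}ex cat_take_drop.
move: e; set c := drop _ _ in ex'; rewrite ex' -catA.
move/eqP; rewrite eqseq_cat // eqxx /= => /eqP e.
case: (leqP (size u) (size c)) => [le_c|lt_c]; [left|right].
  have ec : c = u ++ drop (size u) c.
    move/(congr1 (take (size u))): e; rewrite take_size_cat // takel_cat // => ec.
    by rewrite {1}ec cat_take_drop.
  exists (drop (size u) c); rewrite -ec; split=> //.
  by move/eqP: e; rewrite {1}ec -!catA eqseq_cat // eqxx => /eqP.
have eq_u : c ++ u = u ++ take (size c) y.
  move/(congr1 (take (size (c ++ u)))): e.
  rewrite [c ++ u ++ y']catA [RHS]take_size_cat // size_cat addnC takeD take_size_cat //.
  by rewrite drop_size_cat // => <-.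
exists c, (take (size c) y); split=> //.
by move/eqP: e; rewrite [c ++ _]catA eq_u -!catA eqseq_cat // eqxx => /eqP.
Qed.

Section Overlaps.
Variables (T : eqType) (u : seq T).

(** In [u ++ b = a ++ u], erasing the first [u] leaves [b] and erasing the second leaves [a]; the
    condition says that every such critical pair is trivial. *)
Definition overlaps_commute :=
  forall a b, u ++ b = a ++ u -> size a < size u -> a = b.

Definition irr w := ~~ infix u w.

Lemma irr_cat x y : irr (x ++ y) -> irr x /\ irr y.
Proof.
move=> xy_irr; split; apply: contra xy_irr => /infixP[p [q ->]]; apply/infixP.
  by exists p, (q ++ y); rewrite -!catA.
by exists (x ++ p), q; rewrite -!catA.
Qed.

Lemma irr_short w : size w < size u -> irr w.
Proof. by move=> lt_wu; apply/negP => /size_infix; rewrite leqNgt lt_wu. Qed.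

Local Notation rel := (fun l r : seq T => l = u /\ r = [::]).

(** A relation and not a function: the occurrence of [u] to be erased is left open at each step, and
    uniqueness of [v] then expresses confluence. *)
Inductive nf : seq T -> seq T -> Prop :=
| nf_irr w of irr w : nf w w
| nf_step x y v of nf (x ++ y) v : nf (x ++ u ++ y) v.

Hypothesis u_gt1 : 1 < size u.
Hypothesis ov : overlaps_commute.

Lemma size_cut x y : size (x ++ y) < size (x ++ u ++ y).
Proof.
rewrite !size_cat addnCA -[ltnLHS]add0n ltn_add2r.
by apply: leq_trans u_gt1.
Qed.

Lemma nf_ex w : exists v, nf w v.
Proof.
have [m] := ubnP (size w); elim: m w => // m IHm w lt_w.
case: (boolP (irr w)) => [|/negbNE/infixP[x [y ew]]]; first by exists w; apply: nf_irr.
have [|v nv] := IHm (x ++ y); last by exists v; rewrite ew; apply: nf_step.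
by rewrite -ltnS; apply: leq_ltn_trans lt_w; rewrite ew size_cut.
Qed.

Lemma nf_irr_or_step w v :
  nf w v -> (irr w /\ w = v) \/ (exists x y, w = x ++ u ++ y /\ nf (x ++ y) v).
Proof. by case=> [|x y]; [left|right; exists x, y]. Qed.

Lemma not_irr_occ x y : ~ irr (x ++ u ++ y).
Proof. by move/negP; apply; apply/infixP; exists x, y. Qed.

(** Induction on length, comparing the first erasures of the two derivations. Overlapping
    occurrences leave the same word by [ov]; disjoint ones reach a common word after one more
    erasure each. *)
Lemma nf_uniq w v v' : nf w v -> nf w v' -> v = v'.
Proof.
have [m] := ubnP (size w); elim: m w v v' => // m IHm w v v' lt_w.
move=> /nf_irr_or_step[[w_irr <-]|[x [y [ew nv]]]].
  by case/nf_irr_or_step=> [[]|[x [y [ew _]]]] //; case: (@not_irr_occ x y); rewrite -ew.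
case/nf_irr_or_step=> [[w_irr _]|[x' [y' [ew' nv']]]].
  by case: (@not_irr_occ x y); rewrite -ew.
move: (ew); rewrite ew' => e.
wlog le_x : x y v x' y' v' ew ew' nv nv' e / size x' <= size x.
  move=> H; case/orP: (leq_total (size x') (size x)) => le_x.
    exact: (H x y v x' y' v').
  by apply/esym; apply: (H x' y' v' x y v).
have lt_xy : size (x ++ y) < m.
  by rewrite -ltnS; apply: leq_ltn_trans lt_w; rewrite ew size_cut.
have lt_xy' : size (x' ++ y') < m.
  by rewrite -ltnS; apply: leq_ltn_trans lt_w; rewrite ew' size_cut.
case: (two_occurrences e le_x) => [[z [ex ey']]|[c [d [lt_c ex ey' ecd]]]].
  have [t nt] := nf_ex (x' ++ z ++ y).
  have -> : v = t.
    apply: IHm lt_xy nv _; rewrite ex -!catA; exact: nf_step.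
  apply/esym; apply: IHm lt_xy' nv' _; rewrite ey' catA; apply: nf_step.
  by rewrite -catA.
by apply: IHm lt_xy nv _; rewrite ex (ov ecd lt_c) -catA -ey'.
Qed.

(** For a single erasure one direction is [nf_step], and the other follows from existence and
    uniqueness of normal forms. *)
Lemma mcong_nf v w t : mcong rel v w -> (nf v t <-> nf w t).
Proof.
move=> vw; elim: vw t => {v w} [x y _ _ [-> ->]|w|v w _ IH|v w z _ IH1 _ IH2] t //.
- split=> [nt|]; last exact: nf_step.
  have [t' nt'] := nf_ex (x ++ y).
  by rewrite (nf_uniq nt (nf_step nt')).
- by rewrite IH.
- by rewrite IH1.
Qed.

Lemma irr_mcong v w : irr v -> irr w -> mcong rel v w -> v = w.
Proof.
move=> v_irr w_irr /(mcong_nf v)[/(_ (nf_irr v_irr)) nv _].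
exact: nf_uniq nv (nf_irr w_irr).
Qed.

Lemma nf_mcong w v : nf w v -> irr v /\ mcong rel v w.
Proof.
elim=> {w v} [w ?|x y v _ [? vxy]]; first by split=> //; apply: mc_refl.
split=> //; apply: mc_trans vxy (mc_sym _).
exact: (@mc_step _ rel x y u [::]).
Qed.

Lemma mcong_cut x y : mcong rel (x ++ u ++ y) (x ++ y).
Proof. exact: (@mc_step _ rel x y u [::]). Qed.

Lemma mcong_cutr x : mcong rel (x ++ u) x.
Proof. by have := mcong_cut x [::]; rewrite !cats0. Qed.

Lemma mcong_u_nil : mcong rel u [::].
Proof. exact: (mcong_cutr [::]). Qed.

(* The empty word is not allowed in a semigroup normal form, so the identity
   is represented by [u]. *)
Definition canon w := irr w /\ w <> [::] \/ w = u.

Lemma canon_ex w : exists be, canon be /\ mcong rel be w.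
Proof.
have [v /nf_mcong[v_irr vw]] := nf_ex w.
have [v0|/eqP v_neq] := eqVneq v [::]; last by exists v; split=> //; left.
exists u; split; first by right.
by rewrite v0 in vw; apply: mc_trans mcong_u_nil vw.
Qed.

Lemma irr_nil : irr [::].
Proof. by apply: irr_short; apply: leq_trans u_gt1. Qed.

Lemma canon_inj v w : canon v -> canon w -> mcong rel v w -> v = w.
Proof.
have nil_canon t : irr t -> mcong rel t u -> t = [::].
  move=> t_irr tu; apply: irr_mcong t_irr irr_nil _.
  exact: mc_trans tu mcong_u_nil.
case=> [[v_irr v_neq]|->] [[w_irr w_neq]|->] // vw; first exact: irr_mcong.
  by case: v_neq; apply: nil_canon.
by case: w_neq; apply: nil_canon (mc_sym vw).
Qed.

Lemma canon_irr_mcong v w : irr v -> canon w -> mcong rel v w ->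
  w = v \/ v = [::] /\ w = u.
Proof.
move=> v_irr [[w_irr _]|->] vw; first by left; apply/esym/irr_mcong.
right; split=> //; apply: irr_mcong v_irr irr_nil _.
exact: mc_trans vw mcong_u_nil.
Qed.

(** If [al] is irreducible, [al ++ [:: a]] can contain [u] only as a suffix, so that [u] is [u']
    followed by [a] and erasing it removes [u'] from [al]. The last two cases come from the identity
    being written [u], as the factor [al] or as the result [be]. *)
Lemma canon_mulr a al be (u' := take (size u).-1 u) : canon al -> canon be ->
  mcong rel (al ++ [:: a]) be <->
  [\/ be = al ++ [:: a], u == rcons u' a /\ al = be ++ u', al = u /\ be = [:: a] |
      u == rcons u' a /\ (al = u' /\ be = u)].
Proof.
move=> al_canon be_canon; split; last first.
  case=> [->|[/eqP eu ->]|[-> ->]|[/eqP eu [-> ->]]].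
  - exact: mc_refl.
  - by rewrite -catA cats1 -eu; apply: mcong_cutr.
  - exact: (mcong_cut [::]).
  - by rewrite cats1 -eu; apply: mc_refl.
move=> ab; case: al_canon => [[al_irr al_neq]|al_u]; last first.
  have a_irr : irr [:: a] by apply: irr_short.
  have a_be : mcong rel [:: a] be.
    by apply: mc_trans ab; rewrite al_u; apply/mc_sym/(mcong_cut [::]).
  by case: (canon_irr_mcong a_irr be_canon a_be) => [->|[]//]; apply: Or43.
case: (boolP (irr (al ++ [:: a]))) => [a_irr|/negbNE/infixP[x [y]]].
  by case: (canon_irr_mcong a_irr be_canon ab) => [->|[]]; [apply: Or41|case: (al)].
case/lastP: y => [|y b] e.
  have eu : u = rcons u' a.
    case/lastP: (u) @u' u_gt1 e => // s b; rewrite size_rcons /= -cats1 take_size_cat //.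
    by move=> _; rewrite cats0 catA !cats1 => /rcons_inj[_ ->].
  have eal : al = x ++ u'.
    by move: e; rewrite cats0 eu cats1 -rcons_cat => /rcons_inj[].
  have x_irr : irr x by move: al_irr; rewrite eal => /irr_cat[].
  have x_be : mcong rel x be.
    apply: mc_trans ab; rewrite e cats0; apply: mc_sym.
    exact: mcong_cutr.
  case: (canon_irr_mcong x_irr be_canon x_be) => [-> |[x0 ->]].
    by apply: Or42; rewrite -eu eqxx.
  by apply: Or44; rewrite -eu eqxx eal x0.
(* Here the occurrence of [u] ends before the last letter, hence lies inside the irreducible word
   [al]. *)
case: (@not_irr_occ x y); move: e.
by rewrite -rcons_cat -rcons_cat cats1 => /rcons_inj[<- _].
Qed.

End Overlaps.

(** * Overlaps and compositions *)

Section GroebnerShirshov.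
Variables (K : fieldType) (n : nat).
Implicit Types (u v w : seq 'I_n) (f g : Defs.npoly n K) (F : seq 'I_n -> K).
Local Open Scope ring_scope.

(** The linear functional on polynomials that extends [F]. *)
Definition peval F f : K := \sum_(t <- f) t.1 * F t.2.

Lemma peval_supp F f (s : seq (seq 'I_n)) :
  uniq s -> {subset map snd f <= s} -> peval F f = \sum_(v <- s) pcoef f v * F v.
Proof.
move=> us fs; under [RHS]eq_bigr do rewrite /pcoef mulr_suml.
rewrite (exchange_big_dep xpredT) //= /peval big_seq [RHS]big_seq.
apply: eq_bigr => t tf; rewrite -big_filter (perm_big [:: t.2]) ?big_seq1 //.
apply: uniq_perm; rewrite ?filter_uniq // => v; rewrite mem_filter inE eq_sym.
by case: eqP => // ->; rewrite fs // map_f.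
Qed.

(** Both sides expand over one list of words containing the words of [f] and [g]. This allows a
    functional to be applied to a triviality identity, which is given coefficientwise. *)
Lemma peval_ext F f g : (forall v, pcoef f v = pcoef g v) -> peval F f = peval F g.
Proof.
move=> fg; pose s := undup (map snd (f ++ g)).
rewrite !(@peval_supp F _ s) ?undup_uniq //.
- by under eq_bigr do rewrite fg.
- by move=> v; rewrite mem_undup map_cat mem_cat orbC => ->.
- by move=> v; rewrite mem_undup map_cat mem_cat => ->.
Qed.

Lemma peval_cat F f g : peval F (f ++ g) = peval F f + peval F g.
Proof. exact: big_cat. Qed.

Lemma lex_lt_irr w : ~~ lex_lt w w.
Proof. by elim: w => //= a w IHw; rewrite ltnn eqxx. Qed.

Lemma deglex_lt_irr w : ~~ deglex_lt w w.
Proof. by rewrite /deglex_lt ltnn eqxx lex_lt_irr. Qed.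

Lemma deglex_lt_size v w : deglex_lt v w -> (size v <= size w)%N.
Proof. by case/orP=> [/ltnW|/andP[/eqP->]]. Qed.

Lemma pcoef_unit_rel u v : pcoef (unit_rel_poly K u) v = (u == v)%:R - (v == [::])%:R.
Proof.
rewrite /pcoef !big_cons big_nil /= [[::] == v]eq_sym.
by case: (u == v); case: (v == [::]); rewrite /= ?mulr1n ?mulr0n ?oppr0 ?addr0 ?add0r.
Qed.

Lemma leading_unit_rel u v : u != [::] -> leading_word (unit_rel_poly K u) v <-> v = u.
Proof.
move=> u_neq; split=> [[v1 lead]|->].
  have [||] := lead u; rewrite ?pcoef_unit_rel ?eqxx ?(negPf u_neq) ?subr0 ?oner_eq0 //.
  have [-> //|/eqP uv] := eqVneq u v.
  (* The coefficient of the empty word is [-1], which may equal [1] in [K]; the empty word is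
     excluded because [u] would have to be smaller. *)
  have [->|v_neq] := eqVneq v [::]; first by rewrite /deglex_lt; case: (u) u_neq.
  move: v1; rewrite pcoef_unit_rel (negPf v_neq) (introF eqP uv) subr0 => /esym/eqP.
  by rewrite oner_eq0.
split=> [|t]; rewrite pcoef_unit_rel ?eqxx ?(negPf u_neq) ?subr0 //.
have [->|_] := eqVneq u t; first by left.
have [->|_] := eqVneq t [::]; last by rewrite subr0 eqxx.
by right; rewrite /deglex_lt; case: (u) u_neq.
Qed.

(** The composition of [u - 1] with itself at [u ++ b] is [a - b]. A functional that vanishes on all
    [x (u - 1) y] with [x ++ u ++ y] below [u ++ b], and separates [a] from any other word of its
    length, forces [a = b]. Induction on [size a] makes this functional well behaved. *)
Lemma GS_overlaps u : u != [::] -> GS_basis [:: unit_rel_poly K u] -> overlaps_commute u.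
Proof.
move=> u_neq gs a b.
have [m] := ubnP (size a); elim: m a b => // m IHm a b; rewrite ltnS => le_a eab lt_a.
have lead : leading_word (unit_rel_poly K u) u by apply/leading_unit_rel.
have [/(_ a b (u ++ b) erefl eab) triv _] :=
  gs _ _ (mem_head _ _) (mem_head _ _) _ _ lead lead.
have sab : size a = size b.
  by apply/eqP; move/(congr1 size)/eqP: eab; rewrite !size_cat addnC eqn_add2r eq_sym.
have [|terms [terms_ok eq_terms]] := triv; first by rewrite eab size_cat ltn_add2r.
(* One reduction step, at the leftmost occurrence of [u]; [N_occ] shows that below [u ++ b] any
   other occurrence gives the same result. *)
pose N v := let i := infix_index u v in
  if infix u v then take i v ++ drop (i + size u) v else v.
(* Words below [u ++ b] have a unique one-step reduction, since the only
   unresolved overlap of that length is [u ++ b] itself. *)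
have N_occ x y : deglex_lt (x ++ u ++ y) (u ++ b) -> N (x ++ u ++ y) = x ++ y.
  move=> lt_w; set v := x ++ u ++ y; rewrite /N.
  have v_occ : infix u v by apply/infixP; exists x, y.
  rewrite v_occ; set x' := take _ v; set y' := drop _ v.
  have ev : x' ++ u ++ y' = v.
    move: v_occ; rewrite infixE => /eqP <-.
    by rewrite /y' addnC -drop_drop !cat_take_drop.
  have res p q p' q' : p ++ u ++ q = p' ++ u ++ q' -> p ++ u ++ q = v ->
      (size p <= size p')%N -> p ++ q = p' ++ q'.
    move=> e epq le_p; have lt_v : (size v < size u + size u)%N.
      apply: leq_ltn_trans (deglex_lt_size lt_w) _.
      by rewrite eab size_cat ltn_add2r.
    case: (two_occurrences e le_p) => [[z [_ eq]]|[c [d [lt_c ep' eq ecd]]]].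
      (* Two disjoint occurrences do not fit, since [v] is shorter than [u ++ u]. *)
      by move: lt_v; rewrite -epq eq !size_cat; lia.
    suff ecd' : c = d by rewrite ep' eq ecd' catA.
    have epv : v = p ++ (c ++ u) ++ q' by rewrite -epq eq -ecd -!catA.
    have sv : (size v <= size a + size u)%N.
      by rewrite -(size_cat a u) -eab deglex_lt_size.
    have [lt_ca|le_ac] := ltnP (size c) (size a).
      by apply: IHm ecd lt_c; apply: leq_trans lt_ca le_a.
    (* The length bound leaves no room around the overlap, so [v] is [c ++ u] with [c = a], that is
       [u ++ b] itself, against strictness of [lt_w]. *)
    have [sca p0 q0] : [/\ size c = size a, size p = 0%N & size q' = 0%N].
      move: sv le_ac; rewrite epv !size_cat.
      by move: (size c) (size p) (size u) (size q') (size a) => *; split; lia.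
    have takeE (z t : seq 'I_n) :
      u ++ t = z ++ u -> (size z < size u)%N -> z = take (size z) u.
      move=> /(congr1 (take (size z))) + lt_z.
      by rewrite [RHS]take_size_cat // takel_cat // ltnW.
    move: lt_w; rewrite -/v epv (size0nil p0) (size0nil q0) cats0 /=.
    by rewrite (takeE _ _ ecd lt_c) sca -(takeE _ _ eab lt_a) -eab
       (negPf (deglex_lt_irr _)).
  by case/orP: (leq_total (size x) (size x')) => le_x; [apply/esym|]; apply: res.
have N_short v : (size v < size u)%N -> N v = v.
  by rewrite /N; case: ifP => // /size_infix; rewrite leqNgt => /negP.
pose F v : K := (N v == a)%:R.
have := peval_ext F eq_terms; rewrite /psub peval_cat /peval /= !big_cons !big_nil /=.
rewrite big_flatten big_map big1_seq /=; last first.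
  (* Each term is a multiple of [x (u - 1) y] with [x ++ y] shorter than [u], so [N] sends both
     [x ++ u ++ y] and [x ++ y] to [x ++ y], and the two values of [F] cancel. *)
  move=> t /terms_ok[]; rewrite mem_seq1 => /eqP -> [ls [/leading_unit_rel->//]] lt_w.
  have short : (size (t.1.1.2 ++ t.2) < size u)%N.
    move: (deglex_lt_size lt_w) lt_a; rewrite eab !size_cat.
    by move: (size t.1.1.2) (size t.2) (size u) (size a) => *; lia.
  rewrite !big_cons big_nil /= /F N_occ // (N_short _ short).
  by rewrite mulr1 mulrN1 mulNr addr0 subrr.
(* The contributions of [u ++ b] and [a ++ u] cancel, leaving [F a = F b], where [F a = 1]. *)
rewrite !cats0 !mul1r !mulN1r opprK eab !addr0 addrACA subrr add0r addrC => /eqP.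
rewrite subr_eq0 /F (N_short a) // (N_short b) -?sab // eqxx => /eqP.
by case: eqP => [-> //|_ /eqP]; rewrite /= mul1r mulr1n mulr0n oner_eq0.
Qed.

End GroebnerShirshov.

(** * Biautomaticity *)

Section Biautomatic.
Variable A : finType.
Implicit Types u v al be : seq A.

Local Notation rel u := (fun l r : seq A => l = u /\ r = [::]).

Lemma regular_canon u : regular (canon u).
Proof.
have r_occ := regular_some_suffix (regular_catl u (regular_true A)).
have r_nil := regular_nil A.
apply: regular_ext (regular_or (regular_and (regular_not r_occ) (regular_not r_nil))
  (regular_seq1 u)) => w.
have occP : (exists x y, w = x ++ y /\ exists2 v, y = u ++ v & True) <-> infix u w.
  split=> [[x [_ [-> [v -> _]]]]|/infixP[x [v ->]]]; first by apply/infixP; exists x, v.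
  by exists x, (u ++ v); split=> //; exists v.
rewrite occP /canon /irr; split=> -[[ninf ?]|->]; try by right.
  by left; split=> //; apply/negP.
by left; split=> //; apply/negP.
Qed.

Lemma mcong_rev u v w : mcong (rel u) v w -> mcong (rel (rev u)) (rev v) (rev w).
Proof.
elim=> {v w} [x y _ _ [-> ->]|w|v w _ IH|v w z _ IH1 _ IH2].
- rewrite !rev_cat -!catA.
  exact: (@mc_step _ (rel (rev u)) (rev y) (rev x) (rev u) [::]).
- exact: mc_refl.
- exact: mc_sym.
- exact: mc_trans IH1 IH2.
Qed.

Lemma canon_rev u w : canon u w -> canon (rev u) (rev w).
Proof.
case=> [[w_irr w_neq]|->]; [left|by right]; split; first by rewrite /irr infix_rev.
by move=> e; apply: w_neq; rewrite -(revK w) e.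
Qed.

(** Reversal turns the overlap [(a, b)] of [rev u] into the overlap [(rev b, rev a)] of [u]; the
    length bound transfers because [a] and [b] have equal length. *)
Lemma overlaps_commute_rev u : overlaps_commute u -> overlaps_commute (rev u).
Proof.
move=> ov a b e lt_a; apply: (can_inj revK); apply/esym; apply: ov; last first.
  have /eqP := congr1 size e.
  by rewrite !size_cat addnC eqn_add2r !size_rev in lt_a * => /eqP->.
by apply: (can_inj revK); rewrite !rev_cat !revK e.
Qed.

(** * Right multiplication under either padding *)

Section RightMultiplication.
Variable zp : seq A -> seq A -> seq (option A * option A).
Hypothesis zp_fst : forall al be, pmap fst (zp al be) = al.
Hypothesis zp_swap : forall al be, map (fun p => (p.2, p.1)) (zp al be) = zp be al.
Hypothesis zp_catr : forall s, regular (fun w => exists x, w = zp x (x ++ s)).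

Lemma sync_mulr u (a : option A) : 1 < size u -> overlaps_commute u ->
  sync zp (fun al be => [/\ canon u al, canon u be &
    mcong (rel u) (al ++ seq_of_opt a) be]).
Proof.
move=> u_gt1 ov; have rL := regular_canon u.
case: a => [a|] /=; last first.
  have := sync_fst zp_fst rL (sync_snd zp_fst zp_swap rL (sync_catr zp_catr [::])).
  apply: sync_ext => al be; rewrite !cats0; split=> [[? [? ->]]|[? ?]].
    by split=> //; apply: mc_refl.
  by move/(canon_inj u_gt1 ov) => ->.
pose u' := take (size u).-1 u.
(* The four disjuncts follow [canon_mulr]; the test on the last letter of [u] does not depend on the
   pair of words. *)
have := sync_or (sync_catr zp_catr [:: a])
  (sync_or (sync_andb (u == rcons u' a) (sync_swap zp_swap (sync_catr zp_catr u')))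
  (sync_or (sync_pair zp u [:: a]) (sync_andb (u == rcons u' a) (sync_pair zp u' u)))).
move/(sync_snd zp_fst zp_swap rL)/(sync_fst zp_fst rL).
apply: sync_ext => al be; split=> [[cal [cbe H]]|[cal cbe]].
  split=> //; apply/(canon_mulr u_gt1 ov) => //.
  by case: H => [?|[?|[?|?]]]; [apply: Or41|apply: Or42|apply: Or43|apply: Or44].
move/(canon_mulr u_gt1 ov _ cal cbe) => H; split=> //; split=> //.
by case: H; tauto.
Qed.

End RightMultiplication.

(** * Transfer to [pad2] and reversal of paddings *)

Lemma regular_padR (P : seq A -> seq A -> Prop) :
  sync (@zipR A) P -> regular (fun x => exists al be, x = padR al be /\ P al be).
Proof.
move/(regular_map (val : pad2 A -> _)); apply: regular_ext => w.
split=> -[al [be [e ?]]]; exists al, be; split=> //.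
  by apply: (inj_map val_inj); rewrite val_padR.
by rewrite e val_padR.
Qed.

Lemma regular_padL (P : seq A -> seq A -> Prop) :
  sync (@zipL A) P -> regular (fun x => exists al be, x = padL al be /\ P al be).
Proof.
move/(regular_map (val : pad2 A -> _)); apply: regular_ext => w.
split=> -[al [be [e ?]]]; exists al, be; split=> //.
  by apply: (inj_map val_inj); rewrite val_padL.
by rewrite e val_padL.
Qed.

(** Reversing a padded pair reverses both words and exchanges the two paddings, and regularity
    survives reversal. *)
Lemma sync_zipL_rev (P : seq A -> seq A -> Prop) :
  sync (@zipR A) (fun al be => P (rev al) (rev be)) -> sync (@zipL A) P.
Proof.
move/regular_rev; apply: regular_ext => w.
split=> -[al [be [e ?]]]; exists (rev al), (rev be); rewrite ?revK; split=> //.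
  by rewrite /zipL !revK -e revK.
by rewrite e /zipL revK.
Qed.

Lemma sync_zipR_rev (P : seq A -> seq A -> Prop) :
  sync (@zipL A) (fun al be => P (rev al) (rev be)) -> sync (@zipR A) P.
Proof.
move/regular_rev; apply: regular_ext => w.
split=> -[al [be [e ?]]]; exists (rev al), (rev be); rewrite ?revK; split=> //.
  by rewrite -[LHS]revK e /zipL revK.
by rewrite e /zipL !revK.
Qed.

Lemma biautomatic_of_overlaps u :
  1 < size u -> overlaps_commute u -> biautomatic_pres (rel u).
Proof.
move=> u_gt1 ov.
(* The letters themselves are the generators, and [canon u] contains exactly one word for each
   element. *)
exists A, (fun a => [:: a]), (canon u) => phi.
have phiE al : phi al = al by apply: flatten_seq1.
split; last split; last split; last split.
- move=> b c bc; suff [//] : [:: b] = [:: c].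
  by apply: (irr_mcong u_gt1 ov) bc; apply: irr_short.
- exact: regular_canon.
- by move=> be [[]//|->] u0; rewrite u0 in u_gt1.
- by move=> w; have [be [? ?]] := canon_ex u_gt1 w; exists be; rewrite phiE.
move=> a pa; have paE : pa = seq_of_opt a by rewrite /pa; case: (a).
have revE al be : [/\ canon (rev u) (rev al), canon (rev u) (rev be) &
    mcong (rel (rev u)) (rev al ++ seq_of_opt a) (rev be)] <->
  [/\ canon u al, canon u be & mcong (rel u) (seq_of_opt a ++ al) be].
  have rev_opt : rev (seq_of_opt a) = seq_of_opt a by case: (a).
  split=> -[/canon_rev + /canon_rev + /mcong_rev]; rewrite ?rev_cat ?rev_opt ?revK //.
have ru_gt1 : 1 < size (rev u) by rewrite size_rev.
have rov := overlaps_commute_rev ov.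
have mulrR := sync_mulr (@pmap_fst_zipR A) (@zipR_swap A) (@regular_zipR_catr A) a.
have mulrL := sync_mulr (@pmap_fst_zipL A) (@zipL_swap A) (@regular_zipL_catr A) a.
have regroup (pd : seq A -> seq A -> seq (pad2 A)) (P Q : seq A -> seq A -> Prop) :
    (forall al be, P al be <-> Q al be) ->
  regular (fun x => exists al be, x = pd al be /\
    [/\ canon u al, canon u be & P al be]) ->
  regular (fun x => exists al be,
    [/\ canon u al, canon u be, x = pd al be & Q al be]).
  move=> PQ; apply: regular_ext => x.
  by split=> [[al [be [? [? ? /PQ]]]]|[al [be [? ? ? /PQ]]]]; exists al, be.
split; last split; last split; rewrite paE.
- apply: regroup (regular_padR (mulrR _ u_gt1 ov)) => al be; by rewrite !phiE.
- apply: regroup (regular_padL (mulrL _ u_gt1 ov)) => al be; by rewrite !phiE.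
- apply: (@regroup _ (fun al be => mcong (rel u) (seq_of_opt a ++ al) be)).
    by move=> al be; rewrite !phiE.
  (* Left multiplication under right padding mirrors right multiplication for [rev u] under left
     padding. *)
  apply/regular_padR/sync_zipR_rev; apply: sync_ext (mulrL _ ru_gt1 rov) => al be.
  by rewrite -revE !revK.
- apply: (@regroup _ (fun al be => mcong (rel u) (seq_of_opt a ++ al) be)).
    by move=> al be; rewrite !phiE.
  apply/regular_padL/sync_zipL_rev; apply: sync_ext (mulrR _ ru_gt1 rov) => al be.
  by rewrite -revE !revK.
Qed.

End Biautomatic.

Theorem theorem3p1p4 (K : fieldType) (n k : nat) (u : seq 'I_n) :
  (2 <= k)%N -> size u = k ->
  GS_basis [:: unit_rel_poly K u] ->
  biautomatic_pres (fun l r : seq 'I_n => l = u /\ r = [::]).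
Proof.
move=> k_ge2 size_u gs; rewrite -size_u in k_ge2.
apply: biautomatic_of_overlaps => //; apply: (GS_overlaps _ gs).
by apply/eqP=> u0; rewrite u0 in k_ge2.
Qed.
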